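(* For each $n$, there is a bijection between the set of isomorphism classes of $n$-dimensional commutative Frobenius $\star$-algebras over $\mathbb{C}$ and the set of $n$-tuples of positive real numbers up to permutation.
   Context: A Frobenius $\star$-algebra is a finite-dimensional associative unital $\mathbb{C}$-algebra $A$ with a linear functional $\lambda:A\to\mathbb{C}$ satisfying $\lambda(ab)=\lambda(ba)$ and a map $\star:A\to A$ which is additive, conjugate-linear, involutive, anti-multiplicative ($(ab)^\star=b^\star a^\star$), satisfies $\lambda(a^\star)=\overline{\lambda(a)}$, and such that the Hermitian form $\langle a,b\rangle=\lambda(ab^\star)$ is positive definite (equivalently, admits an orthonormal basis). Isomorphisms of Frobenius $\star$-algebras are algebra isomorphisms compatible with $\lambda$ and $\star$. *)

(* Defs.v *)
From mathcomp Require Import all_boot all_order all_algebra.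
From mathcomp Require Import all_classical all_reals.
From mathcomp Require Import complex.
Set Implicit Arguments.
Unset Strict Implicit.
Unset Printing Implicit Defensive.
Import Order.TTheory GRing.Theory Num.Theory.
Local Open Scope ring_scope.

(* The complex numbers are [R[i]] for [R : realType].  MathComp's [algType]
   forces 1 != 0 and so excludes the zero algebra, of dimension 0; hence the
   multiplication is added here on top of [vectType], whose elements are the
   finite-dimensional vector spaces. *)
Record finDimAlg (R : realType) := FinDimAlg {
  alg_sort :> vectType R[i];
  alg_one : alg_sort;
  alg_mul : alg_sort -> alg_sort -> alg_sort;
  alg_mulA : associative alg_mul;
  alg_mul1l : left_id alg_one alg_mul;
  alg_mul1r : right_id alg_one alg_mul;
  alg_mulDl : left_distributive alg_mul +%R;
  alg_mulDr : right_distributive alg_mul +%R;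
  alg_scaleAl : forall (k : R[i]) a b, k *: alg_mul a b = alg_mul (k *: a) b;
  alg_scaleAr : forall (k : R[i]) a b, k *: alg_mul a b = alg_mul a (k *: b);
}.

Arguments alg_one {R A} : rename.
Arguments alg_mul {R A} : rename.

Declare Scope alg_scope.
Delimit Scope alg_scope with alg.
Notation "a ** b" := (alg_mul a b)
  (at level 40, left associativity) : alg_scope.
Local Open Scope alg_scope.

(* In the order of [R[i]], [0 < z] means that [z] is real and positive.  The
   form [<a, b> = lambda (a ** star b)] is sesquilinear and Hermitian by the
   other axioms, so only its positivity is required. *)
Record frobStarAlg (R : realType) := FrobStarAlg {
  frob_sort :> finDimAlg R;
  lambda : {scalar frob_sort};
  star : frob_sort -> frob_sort;
  lambda_trace : forall a b, lambda (a ** b) = lambda (b ** a);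
  star_add : forall a b, star (a + b) = star a + star b;
  star_conj_linear : forall (k : R[i]) a, star (k *: a) = k^* *: star a;
  star_involutive : involutive star;
  star_antimul : forall a b, star (a ** b) = star b ** star a;
  lambda_star : forall a, lambda (star a) = (lambda a)^*;
  frob_form_posdef : forall a : frob_sort, a != 0 -> 0 < lambda (a ** star a);
}.

Arguments lambda {R A} : rename.
Arguments star {R A} : rename.

Record frob_iso (R : realType) (A B : frobStarAlg R) (f : A -> B) : Prop :=
  FrobIso {
    frob_iso_bij : bijective f;
    frob_iso_linear : linear f;
    frob_iso_one : f alg_one = alg_one;
    frob_iso_mul : forall a b, f (a ** b) = f a ** f b;
    frob_iso_lambda : forall a, lambda (f a) = lambda a;
    frob_iso_star : forall a, f (star a) = star (f a);
  }.

Record comFrobStarAlg (R : realType) (n : nat) := ComFrobStarAlg {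
  com_sort :> frobStarAlg R;
  com_mulC : commutative (@alg_mul R com_sort);
  com_dim : \dim {: com_sort} = n;
}.

Definition isomorphic (R : realType) (n : nat) (A B : comFrobStarAlg R n) :
  Prop := exists f : A -> B, frob_iso f.

(* The classes of an equivalence relation [E], each being represented by the
   predicate satisfied by its elements.  The type [set T] cannot be used for
   [T := comFrobStarAlg R n], for universe reasons. *)
Definition classes (T : Type) (E : T -> T -> Prop) : Type :=
  {C : T -> Prop | exists x, C = E x}.

Definition iso_classes (R : realType) (n : nat) : Type :=
  classes (@isomorphic R n).

Definition pos_tuples_up_to_perm (R : realType) (n : nat) : Type :=
  classes (fun s t : n.-tuple {x : R | 0 < x} => perm_eq s t).

(* Main.v *)
Require Import Defs.
From mathcomp Require Import all_boot all_reals.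
From HB Require Import structures.
From mathcomp Require Import all_order all_algebra perm spectral.
From mathcomp Require Import boolp complex.

(* Positivity of the form makes a commutative Frobenius star-algebra reduced, so
   that a common eigenvector of all multiplications rescales to a primitive
   idempotent.  As long as orthogonal primitive idempotents do not sum to [1],
   such an eigenvector exists in the annihilator of their sum; hence there is a
   basis [e_1, ..., e_n] of orthogonal primitive idempotents.  These are
   self-adjoint with [lambda e_i > 0], and they are intrinsic to the algebra, so
   the multiset of the weights [lambda e_i] is a complete invariant; every
   multiset of weights is realized on [C^n]. *)

Set Implicit Arguments.
Unset Strict Implicit.
Unset Printing Implicit Defensive.
Import Order.TTheory GRing.Theory Num.Theory.
Local Open Scope ring_scope.
Local Open Scope alg_scope.

(** * Bijections between sets of classes *)

(** A class is sent to the set of all elements related to one of its members, which avoids choosing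
    representatives; by the compatibility of [rel] this set is a class. *)
Lemma classes_bij (T U : Type) (E : T -> T -> Prop) (F : U -> U -> Prop)
    (rel : T -> U -> Prop) :
  (forall x, exists s, rel x s) -> (forall s, exists x, rel x s) ->
  (forall x y s t, rel x s -> rel y t -> (E x y <-> F s t)) ->
  exists f : classes E -> classes F, bijective f.
Proof.
move=> relT relU relE.
have fP (C : classes E) :
    exists s, (fun t => exists2 x, sval C x & rel x t) = F s.
  case: C => C [x defC] /=; subst C; have [s xs] := relT x; exists s.
  apply/predeqP => t; split=> [[y xy yt]|st]; first exact/(relE _ _ _ _ xs yt).
  by have [y yt] := relU t; exists y => //; apply/(relE _ _ _ _ xs yt).
have gP (D : classes F) :
    exists x, (fun y => exists2 t, sval D t & rel y t) = E x.
  case: D => D [s defD] /=; subst D; have [x xs] := relU s; exists x.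
  apply/predeqP => y; split=> [[t st yt]|xy]; first exact/(relE _ _ _ _ xs yt).
  by have [t yt] := relT y; exists t => //; apply/(relE _ _ _ _ xs yt).
exists (fun C => exist (fun D => exists s, D = F s) _ (fP C)).
exists (fun D => exist (fun C => exists x, C = E x) _ (gP D)).
- move=> [C [x defC]]; apply: eq_exist => /=; subst C.
  have [s xs] := relT x; apply/predeqP => y; split=> [[t [z xz zt] yt]|xy].
    by apply/(relE _ _ _ _ xs yt)/(relE _ _ _ _ xs zt).
  by have [t yt] := relT y; exists t => //; exists y.
- move=> [D [s defD]]; apply: eq_exist => /=; subst D.
  have [x xs] := relU s; apply/predeqP => t; split=> [[y [u su yu] yt]|st].
    by apply/(relE _ _ _ _ xs yt)/(relE _ _ _ _ xs yu).
  by have [y yt] := relU t; exists y => //; exists t.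
Qed.

(** * Common eigenvectors of commuting endomorphisms *)

(** The rows of [M] are the coordinates of the images of a basis of [U], so a left eigenvector of
    [M] lists the coordinates of [v]. *)
Lemma eigenvector_in (C : numClosedFieldType) (vT : vectType C)
    (f : 'End(vT)) (U : {vspace vT}) :
  U != 0%VS -> (f @: U <= U)%VS ->
  exists c, exists2 v, v \in U & v != 0 /\ f v = c *: v.
Proof.
move=> U0 fU; pose b := vbasis U.
have /freeP b_free : free b := basis_free (vbasisP U).
have bU i : b`_i \in U.
  (* An index past the end yields the default value 0, also in [U]. *)
  have [ltin|leni] := ltnP i (size b); last by rewrite nth_default ?mem0v.
  exact/vbasis_mem/mem_nth.
pose M : 'M_(\dim U) := \matrix_(i, j) coord b j (f b`_i).
have [|c /eigenvalueP[w wM w0]] := eigenvalue_closed M.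
  by rewrite lt0n dimv_eq0.
exists c, (\sum_i w 0 i *: b`_i).
  by apply: memv_suml => i _; apply: memvZ.
split.
  apply: contraNneq w0 => /b_free w0.
  by apply/eqP/rowP => i; rewrite w0 mxE.
rewrite linear_sum scaler_sumr /=.
transitivity (\sum_i \sum_j (w 0 i * M i j) *: b`_j).
  apply: eq_bigr => i _; rewrite linearZ /=.
  rewrite {1}(coord_vbasis (subvP fU _ (memv_img f (bU i)))) scaler_sumr.
  by apply: eq_bigr => j _; rewrite scalerA mxE.
rewrite exchange_big; apply: eq_bigr => j _ /=.
by rewrite -scaler_suml scalerA; have /rowP/(_ j) := wM; rewrite !mxE => ->.
Qed.

(** By induction on the dimension of [U]: if every [f i] is scalar on [U], any nonzero vector will
    do. The index type is arbitrary so as to treat all multiplications of an algebra at once. *)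
Lemma common_eigenvector_in (C : numClosedFieldType) (vT : vectType C)
    (I : Type) (f : I -> 'End(vT)) (U : {vspace vT}) :
  (forall i j v, f i (f j v) = f j (f i v)) ->
  U != 0%VS -> (forall i v, v \in U -> f i v \in U) ->
  exists2 v, v \in U & v != 0 /\ forall i, exists c, f i v = c *: v.
Proof.
move=> fC; have [m] := ubnP (\dim U); elim: m U => // m IHm U leUm U0 fU.
have [scal|/existsNP[i nscal]] :=
  pselect (forall i, exists c, forall v, v \in U -> f i v = c *: v).
  exists (vpick U); first exact: memv_pick.
  split=> [|i]; first by rewrite vpick0.
  by have [c fc] := scal i; exists c; apply/fc/memv_pick.
have [|c [v vU [v0 fv]]] := eigenvector_in U0 (_ : f i @: U <= U)%VS.
  by apply/subvP => _ /memv_imgP[v vU ->]; apply: fU.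
(* A nonscalar [f i] cuts [U] down to a proper common stable subspace. *)
pose K := (U :&: lker (f i - c *: \1%VF))%VS.
have KE w : (w \in K) = (w \in U) && (f i w == c *: w).
  rewrite memv_cap memv_ker add_lfunE opp_lfunE scale_lfunE id_lfunE.
  by rewrite subr_eq0.
have [|||w] := IHm K; last by rewrite KE => /andP[wU _] wP; exists w.
- suff ltKU : (\dim K < \dim U)%N by rewrite (leq_trans ltKU).
  rewrite ltn_neqAle dimvS ?capvSl // andbT; apply/eqP => eqKU.
  apply: nscal; exists c => w; have /eqP <- : K == U.
    by rewrite eqEdim capvSl eqKU /=.
  by rewrite KE => /andP[_ /eqP].
- by apply: contraNneq v0 => K0; rewrite -memv0 -K0 KE vU fv eqxx.
- move=> j w; rewrite !KE => /andP[wU /eqP fw]; rewrite fU //=.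
  by rewrite fC fw linearZ.
Qed.

(** * Orthogonal primitive idempotents and coordinates *)

Lemma alg_mul_is_linear (R : realType) (A : finDimAlg R) (a : A) :
  linear (alg_mul a).
Proof. by move=> k x y; rewrite alg_mulDr -alg_scaleAr. Qed.

HB.instance Definition _ (R : realType) (A : finDimAlg R) (a : A) :=
  GRing.isLinear.Build R[i] A A *:%R (alg_mul a) (alg_mul_is_linear a).

(** Primitivity is encoded as the ideal generated by [e i] being a line. Partial families are
    allowed, since they are built one member at a time. *)
Record idem_family (R : realType) (A : finDimAlg R) k (e : 'I_k -> A) :=
  IdemFamily {
    idem_neq0 : forall i, e i != 0;
    idem_mul : forall i j, e i ** e j = if i == j then e i else 0;
    idem_prim : forall i a, exists c, a ** e i = c *: e i;
  }.

(** The coefficient of [x] along [u]: applying [lambda] to [x ** u = c *: u] gives this formula for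
    [c], visibly linear in [x]. *)
Definition idem_coord (R : realType) (A : frobStarAlg R) (u x : A) : R[i] :=
  lambda (x ** u) / lambda u.

Lemma idem_coord_is_scalar (R : realType) (A : frobStarAlg R) (u : A) :
  scalar (idem_coord u).
Proof.
move=> c x y; rewrite /idem_coord alg_mulDl -alg_scaleAl linearP /=.
by rewrite mulrDl mulrA.
Qed.

HB.instance Definition _ (R : realType) (A : frobStarAlg R) (u : A) :=
  GRing.isLinear.Build R[i] A R[i] *%R (idem_coord u) (idem_coord_is_scalar u).

(** * Reducedness from positivity *)

Section CommutativeFrobenius.
Variables (R : realType) (A : frobStarAlg R).
Hypothesis mulC : commutative (@alg_mul R A).

(** Idempotence gives [c * c = c], and [c] is nonzero because [q] is. *)
Lemma scaled_idem (c : R[i]) (u q : A) :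
  u ** u = u -> q ** q = q -> q != 0 -> q = c *: u -> q = u.
Proof.
move=> uu qq q0 qE; suff c1 : c = 1 by rewrite qE c1 scale1r.
have c0 : c != 0 by apply: contraNneq q0; rewrite qE => ->; rewrite scale0r.
have u0 : u != 0 by apply: contraNneq q0; rewrite qE => ->; rewrite scaler0.
move: qq; rewrite qE -alg_scaleAl -alg_scaleAr uu scalerA => /eqP.
rewrite -subr_eq0 -scalerBl scaler_eq0 (negPf u0) orbF subr_eq0 => /eqP cc.
by apply: (mulfI c0); rewrite cc mulr1.
Qed.

Lemma mul_star_neq0 (a : A) : a != 0 -> a ** star a != 0.
Proof.
move=> /frob_form_posdef; apply: contraTneq => ->.
by rewrite linear0 ltxx.
Qed.

Lemma star_mul_star (a : A) : star (a ** star a) = a ** star a.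
Proof. by rewrite star_antimul star_involutive. Qed.

(* A square-zero [a] would make the self-adjoint [h = a ** star a] square-zero,
   whereas [h ** h = h ** star h != 0]. *)
Lemma sqr_neq0 (a : A) : a != 0 -> a ** a != 0.
Proof.
move=> /mul_star_neq0 h0.
have := mul_star_neq0 h0; rewrite star_mul_star; apply: contraNneq => aa.
by rewrite -alg_mulA [star a ** _]mulC -alg_mulA alg_mulA aa mulC linear0.
Qed.

(** * Coordinates along a family, and its extension *)

Section Family.
Variables (k : nat) (e : 'I_k -> A).
Hypothesis fam : idem_family e.

Lemma idem_id i : e i ** e i = e i.
Proof. by rewrite (idem_mul fam) eqxx. Qed.

Lemma idem_inj : injective e.
Proof.
move=> i j eij; apply/eqP; apply: contraT => nij.
have := idem_neq0 fam i.
by rewrite -idem_id {2}eij (idem_mul fam) (negPf nij) eqxx.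
Qed.

Lemma star_idem i : star (e i) = e i.
Proof.
have [c ec] := idem_prim fam i (star (e i)).
(* The self-adjoint [e i ** star (e i)] is an idempotent multiple of [e i]. *)
have qE : e i ** star (e i) = e i.
  apply: (@scaled_idem c); rewrite ?idem_id //; last by rewrite mulC.
  - rewrite -alg_mulA [star _ ** _]mulC -alg_mulA -star_antimul idem_id.
    by rewrite alg_mulA idem_id.
  - exact/mul_star_neq0/(idem_neq0 fam).
by rewrite -[in LHS]qE star_mul_star.
Qed.

(** Since [e i] is a self-adjoint idempotent, [lambda (e i)] is its squared norm. *)
Lemma lambda_idem_gt0 i : 0 < lambda (e i).
Proof.
by have := frob_form_posdef (idem_neq0 fam i); rewrite star_idem idem_id.
Qed.

Lemma mul_idem x i : x ** e i = idem_coord (e i) x *: e i.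
Proof.
have [c xE] := idem_prim fam i x; rewrite /idem_coord xE linearZ /= mulfK //.
by rewrite gt_eqF ?lambda_idem_gt0.
Qed.

Lemma idem_coordP c x i : x ** e i = c *: e i -> idem_coord (e i) x = c.
Proof.
rewrite mul_idem => /eqP; rewrite -subr_eq0 -scalerBl scaler_eq0.
by rewrite (negPf (idem_neq0 fam i)) orbF subr_eq0 => /eqP.
Qed.

Lemma idem_coord1 i : idem_coord (e i) alg_one = 1.
Proof. by apply: idem_coordP; rewrite alg_mul1l scale1r. Qed.

(** With the values at [alg_one] and [star x], this makes each coordinate a star-preserving
    character. *)
Lemma idem_coordM x y i :
  idem_coord (e i) (x ** y) = idem_coord (e i) x * idem_coord (e i) y.
Proof.
apply: idem_coordP; rewrite -alg_mulA !mul_idem -alg_scaleAr mul_idem.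
by rewrite scalerA mulrC.
Qed.

Lemma idem_coord_star x i : idem_coord (e i) (star x) = (idem_coord (e i) x)^*.
Proof.
apply: idem_coordP; rewrite -{1}star_idem -star_antimul mulC mul_idem.
by rewrite star_conj_linear star_idem.
Qed.

Lemma idem_coord_idem i j : idem_coord (e j) (e i) = (i == j)%:R.
Proof.
apply: idem_coordP; rewrite (idem_mul fam).
by case: eqP => [->|_]; rewrite ?scale1r ?scale0r.
Qed.

Lemma idem_coord_sum (c : 'I_k -> R[i]) i :
  idem_coord (e i) (\sum_j c j *: e j) = c i.
Proof.
rewrite linear_sum (bigD1 i) //= big1 => [|j nji];
  rewrite linearZ /= idem_coord_idem.
  by rewrite eqxx mulr1 addr0.
by rewrite (negPf nji) mulr0.
Qed.

Lemma idem_free : free [tuple e i | i < k].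
Proof.
apply/freeP => c; under eq_bigr do rewrite -tnth_nth tnth_mktuple.
by move=> c0 i; rewrite -(idem_coord_sum c) c0 linear0.
Qed.

Lemma idem_count : (k <= \dim {: A})%N.
Proof.
have /eqP := idem_free; rewrite size_tuple => <-.
exact/dimvS/subvf.
Qed.

(** The annihilator [J] of [p] is an ideal; a common eigenvector in [J] of all multiplications is
    orthogonal to the family and generates a line, so it only has to be rescaled. *)
Lemma idem_extend : \sum_i e i != alg_one ->
  exists e' : 'I_k.+1 -> A, idem_family e'.
Proof.
set p := \sum_i e i => p1.
have mulpe i : p ** e i = e i.
  rewrite mul_idem /p (eq_bigr (fun j => 1 *: e j)) => [|j _].
    by rewrite idem_coord_sum scale1r.
  by rewrite scale1r.
have mulpp : p ** p = p.
  by rewrite -[RHS](eq_bigr _ (fun i _ => mulpe i)) -linear_sum.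
pose L a := linfun (alg_mul a) : 'End(A).
have LE a x : L a x = a ** x by rewrite lfunE.
pose J := lker (L p).
have JE x : (x \in J) = (p ** x == 0) by rewrite memv_ker LE.
have [|||u uJ [u0 uP]] := @common_eigenvector_in _ _ _ L J.
- by move=> a b x; rewrite !LE !alg_mulA [a ** b]mulC.
(* [J] contains [alg_one - p], which is nonzero. *)
- apply: contraNneq p1 => J0; rewrite eq_sym -subr_eq0 -memv0 -J0 JE.
  by rewrite linearB /= mulpp alg_mul1r subrr.
- move=> a x; rewrite !JE LE alg_mulA [p ** a]mulC -alg_mulA => /eqP->.
  by rewrite linear0.
(* Here [e i = p ** e i], while [p ** u = 0]. *)
have eu i : e i ** u = 0.
  rewrite -mulpe -alg_mulA mulC -alg_mulA [u ** p]mulC.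
  by move: uJ; rewrite JE => /eqP->; rewrite linear0.
have [c] := uP u; rewrite LE => uu.
have c0 : c != 0.
  by apply: contraNneq (sqr_neq0 u0); rewrite uu => ->; rewrite scale0r.
pose v := c^-1 *: u.
have ev i : e i ** v = 0 by rewrite linearZ /= eu scaler0.
(* The new idempotent gets the last index, where [unlift ord_max] is [None]. *)
pose e' i := oapp e v (unlift ord_max i).
exists e'; split.
- move=> i; rewrite /e'; case: unliftP => [j|] _ /=; first exact: idem_neq0.
  by rewrite scaler_eq0 invr_eq0 negb_or c0.
- move=> i j; rewrite /e'; case: (unliftP ord_max i) => [i'|] ->;
    case: (unliftP ord_max j) => [j'|] -> /=.
  + by rewrite (idem_mul fam) (inj_eq lift_inj).
  + by rewrite ev eq_sym (negPf (neq_lift _ _)).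
  + by rewrite mulC ev (negPf (neq_lift _ _)).
  + by rewrite eqxx -alg_scaleAl linearZ /= uu !scalerA -mulrA mulVf // mulr1.
- move=> i a; rewrite /e'; case: unliftP => [j|] _ /=; first exact: idem_prim.
  have [d] := uP a; rewrite LE => ad.
  by exists d; rewrite linearZ /= ad !scalerA mulrC.
Qed.

End Family.

(** Starting from the empty family: [k] idempotents summing to [alg_one] would span [A], so a family
    smaller than the dimension can be extended. *)
Lemma idem_family_exists k :
  (k <= \dim {: A})%N -> exists e : 'I_k -> A, idem_family e.
Proof.
elim: k => [_|k IHk ltkn]; first by exists (fun=> 0); split=> -[].
have [e fam] := IHk (ltnW ltkn); apply: (idem_extend fam).
apply: contraTneq ltkn => p1; rewrite -leqNgt.
rewrite -[leqRHS](size_tuple [tuple e i | i < k]).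
apply: leq_trans (dim_span _); apply/dimvS/subvP => x _.
rewrite -[x]alg_mul1r -p1 linear_sum; apply: memv_suml => i _ /=.
rewrite (mul_idem fam); apply/memvZ/memv_span.
by rewrite -(tnth_mktuple e i) mem_tnth.
Qed.

(** * Complete families: decomposition and uniqueness *)

Section Complete.
Variables (n : nat) (e : 'I_n -> A).
Hypotheses (dimA : \dim {: A} = n) (fam : idem_family e).

(** Otherwise the family would extend to [n.+1] independent elements. *)
Lemma idem_sum1 : \sum_i e i = alg_one.
Proof.
apply/eqP/contraT => /(idem_extend fam)[e' /idem_count].
by rewrite dimA ltnn.
Qed.

Lemma idem_decomp x : x = \sum_i idem_coord (e i) x *: e i.
Proof.
rewrite -[LHS]alg_mul1r -idem_sum1 linear_sum.
by apply: eq_bigr => i _; apply: mul_idem.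
Qed.

Lemma idem_coord_inj x y :
  (forall i, idem_coord (e i) x = idem_coord (e i) y) -> x = y.
Proof.
move=> xy; rewrite (idem_decomp x) (idem_decomp y).
by apply: eq_bigr => i _; rewrite xy.
Qed.

(** Since the [e j] sum to [alg_one], some [e' i ** e j] is nonzero; it is an idempotent and a
    scalar multiple of both factors, hence equal to both. *)
Lemma idem_unique k (e' : 'I_k -> A) i :
  idem_family e' -> exists j, e' i = e j.
Proof.
move=> fam'; have [j ej] : exists j, e' i ** e j != 0.
  apply/existsP/contraT; rewrite negb_exists => /forallP e0.
  have := idem_neq0 fam' i; rewrite -[e' i]alg_mul1r -idem_sum1 linear_sum.
  by rewrite big1 ?eqxx // => j _; apply/eqP; rewrite -[_ == _]negbK e0.
exists j; have qq : (e' i ** e j) ** (e' i ** e j) = e' i ** e j.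
  rewrite -alg_mulA [e j ** _]mulC -alg_mulA (idem_id fam) alg_mulA.
  by rewrite (idem_id fam').
have [c ec] := idem_prim fam j (e' i).
have [d ed] := idem_prim fam' i (e j).
rewrite -[RHS](scaled_idem (idem_id fam j) qq ej ec).
by apply/esym/(scaled_idem (idem_id fam' i) qq ej (c := d)); rewrite mulC.
Qed.

End Complete.

End CommutativeFrobenius.

(** * Isomorphisms and idempotent families *)

Section Isomorphism.
Variables (R : realType) (n : nat) (A B : comFrobStarAlg R n).

Lemma idem_family_iso k (e : 'I_k -> A) (f : A -> B) :
  frob_iso f -> idem_family e -> idem_family (f \o e).
Proof.
move=> [f_bij f_lin _ fM _ _] fam.
pose F : {linear A -> B} := HB.pack f (GRing.isLinear.Build _ _ _ _ f f_lin).
have f0 : f 0 = 0 by apply: (linear0 F).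
split=> [i|i j|i b] /=.
- by rewrite -f0 (inj_eq (bij_inj f_bij)) idem_neq0.
- by rewrite -fM (idem_mul fam); case: eqP.
- have [g _ gK] := f_bij; have [c gc] := idem_prim fam i (g b).
  by exists c; rewrite -{1}[b]gK -fM gc; apply: (linearZ_LR F).
Qed.

(** The linear map sending [e i] to [e' i] preserves coordinates, which determine the unit, product
    and star; equal weights give compatibility with [lambda]. *)
Lemma idem_family_isomorphic (e : 'I_n -> A) (e' : 'I_n -> B) :
  idem_family e -> idem_family e' ->
  (forall i, lambda (e i) = lambda (e' i)) -> isomorphic A B.
Proof.
move=> famA famB le.
have mulA := @com_mulC _ _ A; have mulB := @com_mulC _ _ B.
have dimA := com_dim A; have dimB := com_dim B.
pose f (x : A) : B := \sum_i idem_coord (e i) x *: e' i.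
have fE x i : idem_coord (e' i) (f x) = idem_coord (e i) x.
  exact: (idem_coord_sum mulB famB).
have injA := idem_coord_inj mulA dimA famA.
have injB := idem_coord_inj mulB dimB famB.
exists f; split.
- exists (fun y => \sum_i idem_coord (e' i) y *: e i) => x.
    by apply: injA => i; rewrite (idem_coord_sum mulA famA) fE.
  by apply: injB => i; rewrite fE (idem_coord_sum mulA famA).
- by move=> c x y; apply: injB => i; rewrite linearP /= !fE linearP.
- by apply: injB => i; rewrite fE !idem_coord1.
- by move=> x y; apply: injB => i; rewrite fE !idem_coordM // !fE.
- move=> x; rewrite [in RHS](idem_decomp mulA dimA famA x) !linear_sum.
  by apply: eq_bigr => i _; rewrite !linearZ /= le.
- by move=> x; apply: injB => i; rewrite fE !idem_coord_star // fE.
Qed.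

End Isomorphism.

(** * Weights, and the algebra with prescribed weights *)

(** The correspondence given to [classes_bij]. The order of [t] follows the indexing of [e], so an
    algebra is related to every permutation of its weights. *)
Definition has_weights (R : realType) (n : nat) (A : comFrobStarAlg R n)
    (t : n.-tuple {x : R | 0 < x}) : Prop :=
  exists2 e : 'I_n -> A, idem_family e &
    forall i, lambda (e i) = (val (tnth t i))%:C%C.

Lemma has_weights_exists (R : realType) (n : nat) (A : comFrobStarAlg R n) :
  exists t, has_weights A t.
Proof.
have mulA := @com_mulC _ _ A.
have [|e fam] := @idem_family_exists _ A mulA n; first by rewrite com_dim.
have le i : exists x : {x : R | 0 < x}, lambda (e i) = (val x)%:C%C.
  have l0 := lambda_idem_gt0 mulA fam i.
  (* Positivity in [R[i]] includes being real, so the weight equals its real part. *)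
  have lE := RRe_real (gtr0_real l0).
  have x0 : 0 < complex.Re (lambda (e i)).
    by move: l0; rewrite ltcE => /andP[].
  by exists (exist (fun x : R => 0 < x) _ x0); rewrite /= lE.
have [w lw] := choice le.
by exists [tuple w i | i < n], e => // i; rewrite tnth_mktuple.
Qed.

(* [C^n] with pointwise operations and [lambda] weighted by [t]. *)
Section Model.
Variables (R : realType) (n : nat) (t : n.-tuple {x : R | 0 < x}).
Local Notation V := 'rV[R[i]]_n.

Let w i : R[i] := (val (tnth t i))%:C%C.

Lemma model_weight_gt0 i : 0 < w i.
Proof. by rewrite /w (ltcR 0); apply: valP. Qed.

Definition model_mul (x y : V) : V := \row_i (x 0 i * y 0 i).

Lemma model_mulA : associative model_mul.
Proof. by move=> x y z; apply/rowP => i; rewrite !mxE mulrA. Qed.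

Lemma model_mul1l : left_id (const_mx 1) model_mul.
Proof. by move=> x; apply/rowP => i; rewrite !mxE mul1r. Qed.

Lemma model_mul1r : right_id (const_mx 1) model_mul.
Proof. by move=> x; apply/rowP => i; rewrite !mxE mulr1. Qed.

Lemma model_mulDl : left_distributive model_mul +%R.
Proof. by move=> x y z; apply/rowP => i; rewrite !mxE mulrDl. Qed.

Lemma model_mulDr : right_distributive model_mul +%R.
Proof. by move=> x y z; apply/rowP => i; rewrite !mxE mulrDr. Qed.

Lemma model_scaleAl (k : R[i]) x y : k *: model_mul x y = model_mul (k *: x) y.
Proof. by apply/rowP => i; rewrite !mxE mulrA. Qed.

Lemma model_scaleAr (k : R[i]) x y : k *: model_mul x y = model_mul x (k *: y).
Proof. by apply/rowP => i; rewrite !mxE mulrCA. Qed.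

Lemma model_mulC : commutative model_mul.
Proof. by move=> x y; apply/rowP => i; rewrite !mxE mulrC. Qed.

Definition model_alg : finDimAlg R :=
  @FinDimAlg R V (const_mx 1) model_mul model_mulA model_mul1l model_mul1r
    model_mulDl model_mulDr model_scaleAl model_scaleAr.

Definition model_lambda (x : V) : R[i] := \sum_i w i * x 0 i.

Lemma model_lambda_is_scalar : scalar model_lambda.
Proof.
move=> k x y; rewrite /model_lambda mulr_sumr -big_split; apply: eq_bigr => i _.
by rewrite !mxE mulrDr mulrCA.
Qed.

HB.instance Definition _ :=
  GRing.isLinear.Build R[i] V R[i] *%R model_lambda model_lambda_is_scalar.

Definition model_star (x : V) : V := map_mx Num.conj x.

Lemma model_lambda_trace (x y : V) :
  model_lambda (model_mul x y) = model_lambda (model_mul y x).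
Proof. by rewrite model_mulC. Qed.

Lemma model_star_add (x y : V) :
  model_star (x + y) = model_star x + model_star y.
Proof. exact: map_mxD. Qed.

Lemma model_star_conj_linear (k : R[i]) (x : V) :
  model_star (k *: x) = k^* *: model_star x.
Proof. exact: map_mxZ. Qed.

Lemma model_star_involutive : involutive model_star.
Proof. by move=> x; apply/rowP => i; rewrite !mxE conjCK. Qed.

Lemma model_star_antimul (x y : V) :
  model_star (model_mul x y) = model_mul (model_star y) (model_star x).
Proof. by apply/rowP => i; rewrite !mxE rmorphM mulrC. Qed.

Lemma model_lambda_star (x : V) :
  model_lambda (model_star x) = (model_lambda x)^*.
Proof.
rewrite /model_lambda rmorph_sum; apply: eq_bigr => i _.
by rewrite mxE rmorphM /= (CrealP (gtr0_real (model_weight_gt0 i))).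
Qed.

(** The form is the sum of the [w i * |x_i|^2], nonnegative terms that all vanish only at
    [x = 0]. *)
Lemma model_form_posdef (x : V) :
  x != 0 -> 0 < model_lambda (model_mul x (model_star x)).
Proof.
have ge0 i : 0 <= w i * (model_mul x (model_star x)) 0 i.
  by rewrite !mxE mulr_ge0 ?mul_conjC_ge0 // ltW ?model_weight_gt0.
rewrite lt0r sumr_ge0 // andbT; apply: contraNneq => /psumr_eq0P x0.
apply/eqP/rowP => i; have /eqP := x0 (fun i _ => ge0 i) i isT.
by rewrite !mxE mulf_eq0 mul_conjC_eq0 gt_eqF ?model_weight_gt0 //= => /eqP.
Qed.

Definition model_frob : frobStarAlg R :=
  @FrobStarAlg R model_alg model_lambda model_star model_lambda_trace
    model_star_add model_star_conj_linear model_star_involutive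
    model_star_antimul model_lambda_star model_form_posdef.

Lemma model_dim : \dim {: model_frob} = n.
Proof. by rewrite dimvf dim_matrix mul1r. Qed.

Definition model : comFrobStarAlg R n :=
  @ComFrobStarAlg R n model_frob model_mulC model_dim.

Lemma model_has_weights : has_weights model t.
Proof.
exists (fun i => delta_mx 0 i : V) => [|i].
  split=> [i|i j|i a].
  - by apply/eqP => /rowP/(_ i)/eqP; rewrite !mxE !eqxx oner_eq0.
  - apply/rowP => l; rewrite !mxE /= -natrM mulnb.
    have [->|nij] := eqVneq i j; first by rewrite mxE andbb.
    (* The zero of the algebra is read as the zero row vector, so that [mxE] applies. *)
    rewrite -[RHS]/((0 : V) 0 l) mxE.
    by have [->|] := eqVneq l i; rewrite ?(negPf nij).
  - exists ((a : V) 0 i); apply/rowP => l; rewrite !mxE /=.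
    by case: eqP => [->|]; rewrite ?mulr0.
rewrite /lambda /= /model_lambda (bigD1 i) //= big1 => [|j nji].
  by rewrite !mxE !eqxx mulr1 addr0.
by rewrite !mxE (negPf nji) mulr0.
Qed.

End Model.

(** * Isomorphism as permutation of weights *)

(** An isomorphism carries [e] to an idempotent family of [B], which by uniqueness is [e'] reindexed
    by an injective [p]; conversely, reindexing [e'] absorbs a permutation of the weights. *)
Lemma isomorphic_perm_eq (R : realType) (n : nat)
    (A B : comFrobStarAlg R n) s t :
  has_weights A s -> has_weights B t -> isomorphic A B <-> perm_eq s t.
Proof.
move=> [e famA les] [e' famB let']; split=> [[f isof]|/tuple_permP[p sE]].
  have mulB := @com_mulC _ _ B; have fam := idem_family_iso isof famA.
  have /choice[p pE] i := idem_unique mulB (com_dim B) famB i fam.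
  have p_inj : injective p.
    by move=> i j pij; apply: (idem_inj fam); rewrite !pE pij.
  apply/tuple_permP; exists (perm p_inj); congr val.
  apply/eq_from_tnth => i; rewrite tnth_mktuple permE; apply/val_inj/complexI.
  by rewrite -les -let' -pE /= (frob_iso_lambda isof).
apply: (@idem_family_isomorphic _ _ _ _ e (e' \o p)) => // [|i].
  split=> [i|i j|i a] /=; first exact: idem_neq0.
    by rewrite (idem_mul famB) (inj_eq perm_inj).
  exact: idem_prim.
by rewrite les /= let' (val_inj sE : s = _) tnth_mktuple.
Qed.

Theorem corollary2p11 (R : realType) (n : nat) :
  exists f : iso_classes R n -> pos_tuples_up_to_perm R n, bijective f.
Proof.
apply: (@classes_bij _ _ _ _ (@has_weights R n)).
- exact: has_weights_exists.
- by move=> t; exists (model t); apply: model_has_weights.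
- exact: isomorphic_perm_eq.
Qed.
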